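(* Let $A\in\mathbb{R}^{m\times n}$, $g(z)=(A^\top z^{\mathsf y},-Az^{\mathsf x})$, and $w_0\in\mathcal{Z}$. In the $\ell_1$-$\ell_1$ setup, the estimator $$\tilde g_{w_0}(w)=g(w_0)+\Big(A_{i:}\,\|w^{\mathsf y}-w_0^{\mathsf y}\|_1\,\mathrm{sign}([w^{\mathsf y}-w_0^{\mathsf y}]_i),\ -A_{:j}\,\|w^{\mathsf x}-w_0^{\mathsf x}\|_1\,\mathrm{sign}([w^{\mathsf x}-w_0^{\mathsf x}]_j)\Big),$$ where $i$ and $j$ are drawn independently with probabilities $$p_i(w)=\frac{|[w^{\mathsf y}]_i-[w_0^{\mathsf y}]_i|}{\|w^{\mathsf y}-w_0^{\mathsf y}\|_1},\qquad q_j(w)=\frac{|[w^{\mathsf x}]_j-[w_0^{\mathsf x}]_j|}{\|w^{\mathsf x}-w_0^{\mathsf x}\|_1},$$ is $(w_0,L)$-centered for $g$ with $L=\|A\|_{\max}=\max_{i,j}|A_{ij}|$.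
   Context: $\ell_1$-$\ell_1$ setup: $\mathcal{X}=\Delta^n$, $\mathcal{Y}=\Delta^m$ (probability simplices), $\mathcal{Z}=\mathcal{X}\times\mathcal{Y}$; $z^{\mathsf x},z^{\mathsf y}$ are the first $n$ and last $m$ coordinates of $z$; norm $\|z\|=\sqrt{\|z^{\mathsf x}\|_1^2+\|z^{\mathsf y}\|_1^2}$, dual norm $\|\gamma\|_*=\sqrt{\|\gamma^{\mathsf x}\|_\infty^2+\|\gamma^{\mathsf y}\|_\infty^2}$. $A_{i:},A_{:j}$ are the $i$th row and $j$th column of $A$ as vectors; $[v]_i$ is the $i$th coordinate. If $w^{\mathsf y}=w_0^{\mathsf y}$ (resp. $w^{\mathsf x}=w_0^{\mathsf x}$) the corresponding increment is $0$. A stochastic estimator $\tilde g_{w_0}:\mathcal{Z}\to\mathcal{Z}^*$ is $(w_0,L)$-centered for $g$ if for all $w\in\mathcal{Z}$: (1) $\mathbb{E}[\tilde g_{w_0}(w)]=g(w)$; (2) $\mathbb{E}\|\tilde g_{w_0}(w)-g(w_0)\|_*^2\le L^2\|w-w_0\|^2$. *)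

(* Defs.v *)
From HB Require Import structures.
From mathcomp Require Import all_boot all_order all_algebra.
From mathcomp Require Import all_classical all_reals all_analysis.

Set Implicit Arguments.
Unset Strict Implicit.
Unset Printing Implicit Defensive.

Import Order.TTheory GRing.Theory Num.Theory.
Import numFieldNormedType.Exports.

Local Open Scope classical_set_scope.
Local Open Scope ring_scope.

(* A vector z of R^n x R^m, or a covector, is the pair (z^x, z^y) = (z.1, z.2). *)
Notation vec R n m := ('cV[R]_n * 'cV[R]_m)%type.

Section Geometry.
Context {R : realType}.

Definition l1norm (k : nat) (v : 'cV[R]_k) : R := \sum_i `|v i 0|.

Definition simplex (k : nat) : set 'cV[R]_k :=
  [set v | (forall i, 0 <= v i 0) /\ \sum_i v i 0 = 1].

Definition Zdom (n m : nat) : set (vec R n m) :=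
  [set z | simplex z.1 /\ simplex z.2].

Definition znorm (n m : nat) (z : vec R n m) : R :=
  Num.sqrt (l1norm z.1 ^+ 2 + l1norm z.2 ^+ 2).

(* [mx_norm] is the largest absolute value of an entry: the l_oo norm on
   column vectors, and ||A||_max on matrices. *)
Definition dual_znorm (n m : nat) (u : vec R n m) : R :=
  Num.sqrt (mx_norm u.1 ^+ 2 + mx_norm u.2 ^+ 2).

Definition gradmap (m n : nat) (A : 'M[R]_(m, n)) (z : vec R n m) : vec R n m :=
  (A^T *m z.2, - (A *m z.1)).

(* Only meaningful when [w.2 != w0.2]; otherwise the quotient is 0/0, which
   evaluates to 0, and [row_prob] is not a probability vector. *)
Definition row_prob (n m : nat) (w0 w : vec R n m) (i : 'I_m) : R :=
  `|w.2 i 0 - w0.2 i 0| / l1norm (w.2 - w0.2).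

(* Likewise only meaningful when [w.1 != w0.1]. *)
Definition col_prob (n m : nat) (w0 w : vec R n m) (j : 'I_n) : R :=
  `|w.1 j 0 - w0.1 j 0| / l1norm (w.1 - w0.1).

(* The value of the estimator at [w] once the indices [i] and [j] are drawn.
   If [w.2 = w0.2] the first increment is 0 whatever [i] is, because of the
   factor [l1norm (w.2 - w0.2)]; likewise for the second one. *)
Definition estimate (m n : nat) (A : 'M[R]_(m, n)) (w0 w : vec R n m)
    (i : 'I_m) (j : 'I_n) : vec R n m :=
  gradmap A w0 +
  ((l1norm (w.2 - w0.2) * Num.sg ((w.2 - w0.2) i 0)) *: (row i A)^T,
   - ((l1norm (w.1 - w0.1) * Num.sg ((w.1 - w0.1) j 0)) *: col j A)).

End Geometry.

Arguments Zdom {R} n m _.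

Section Probability.
Context {R : realType} {d : measure_display} {T : measurableType d}.
Variable P : probability T R.

(* ['I_k] carries the discrete sigma-algebra. *)
Definition random_index (k : nat) (I : T -> 'I_k) : Prop :=
  forall B : set 'I_k, measurable (I @^-1` B).

Definition independent_indices (k l : nat) (I : T -> 'I_k) (J : T -> 'I_l)
    : Prop :=
  forall (B : set 'I_k) (C : set 'I_l),
    P (I @^-1` B `&` J @^-1` C) = (P (I @^-1` B) * P (J @^-1` C))%E.

(* Integrability is required explicitly: 'E_P[_] is total, so the equation
   alone does not display it. *)
Definition has_mean (n m : nat) (X : T -> vec R n m) (v : vec R n m) : Prop :=
  (forall k, P.-integrable setT (EFin \o (fun t => (X t).1 k 0)) /\
     'E_P[(fun t => (X t).1 k 0)%R]%E = (v.1 k 0)%:E) /\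
  (forall k, P.-integrable setT (EFin \o (fun t => (X t).2 k 0)) /\
     'E_P[(fun t => (X t).2 k 0)%R]%E = (v.2 k 0)%:E).

Definition centered (n m : nat) (w0 : vec R n m) (L : R)
    (g : vec R n m -> vec R n m) (gt : vec R n m -> T -> vec R n m) : Prop :=
  forall w, Zdom n m w ->
    has_mean (gt w) (g w) /\
    ('E_P[(fun t => dual_znorm (gt w t - g w0) ^+ 2)%R]
       <= (L ^+ 2 * znorm (w - w0) ^+ 2)%:E)%E.

End Probability.

(* Main.v *)
(* An increment |v|_1 sign(v_i) a_i, with i drawn with probability |v_i| / |v|_1,
   has mean sum_i v_i a_i, since |v_i| sign(v_i) = v_i. Its modulus is at most
   |v|_1 max_i |a_i| for every i, so the second-moment bound already holds
   pointwise. *)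
Require Import Defs.
From HB Require Import structures.
From mathcomp Require Import all_boot all_order all_algebra.
From mathcomp Require Import all_classical all_reals all_analysis.
From mathcomp Require Import ring measurable_realfun.

Set Implicit Arguments.
Unset Strict Implicit.
Unset Printing Implicit Defensive.

Import Order.TTheory GRing.Theory Num.Theory.
Import numFieldNormedType.Exports.

Local Open Scope classical_set_scope.
Local Open Scope ring_scope.

Section Norms.
Context {R : realType}.

Lemma l1norm_ge0 (k : nat) (v : 'cV[R]_k) : 0 <= l1norm v.
Proof. exact: sumr_ge0. Qed.

Lemma l1norm_eq0 (k : nat) (v : 'cV[R]_k) : l1norm v = 0 -> v = 0.
Proof.
move=> /eqP; rewrite psumr_eq0// => /allP v0.
apply/colP => i; rewrite mxE; apply/eqP; rewrite -normr_eq0.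
exact: v0 (mem_index_enum i).
Qed.

Lemma mx_norm_ge0 (m n : nat) (A : 'M[R]_(m, n)) : 0 <= mx_norm A.
Proof. by rewrite mx_normE. Qed.

(** The hypothesis [0 <= c] covers a matrix without entries, whose norm is the default value 0 of
    the maximum. *)
Lemma mx_norm_le (m n : nat) (A : 'M[R]_(m, n)) (c : R) : 0 <= c ->
  (forall i j, `|A i j| <= c) -> mx_norm A <= c.
Proof. by move=> c0 Ac; rewrite mx_normrE; apply: bigmax_le => // -[i j] _. Qed.

Lemma ler_mx_norm (m n : nat) (A : 'M[R]_(m, n)) (i : 'I_m) (j : 'I_n) :
  `|A i j| <= mx_norm A.
Proof.
by rewrite mx_normrE; exact: (le_bigmax _ (fun ij => `|A ij.1 ij.2|) (i, j)).
Qed.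

Lemma normr_sg_le1 (x : R) : `|Num.sg x| <= 1.
Proof. by rewrite normr_sg lern1 leq_b1. Qed.

End Norms.

Section SampledIndex.
Context {R : realType} {d : measure_display} {T : measurableType d}.
Variables (P : probability T R) (k : nat) (I : T -> 'I_k).
Hypothesis mI : random_index I.

Lemma measurable_index (f : 'I_k -> R) :
  measurable_fun setT (fun t => f (I t)).
Proof. by move=> _ B mB; rewrite setTI; exact: (mI (f @^-1` B)). Qed.

(** Exhibits a function of the index as a finite combination of indicators; integrability and
    expectation then reduce to those of the events [I = i]. *)
Lemma index_indic (f : 'I_k -> R) (t : T) :
  f (I t) = \sum_i f i * \1_(I @^-1` [set i]) t.
Proof.
rewrite (bigD1 (I t))//= big1 => [|i iIt]; rewrite indicE.
  by rewrite mem_set// mulr1 addr0.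
by rewrite memNset ?mulr0// => /= Iti; rewrite Iti eqxx in iIt.
Qed.

Lemma integrable_index (f : 'I_k -> R) :
  P.-integrable setT (EFin \o (fun t => f (I t))).
Proof.
apply: (eq_integrable _
    (fun t => (\sum_i (f i)%:E * (\1_(I @^-1` [set i]) t)%:E)%E)) => //.
  by move=> t _ /=; rewrite index_indic -sumEFin.
apply: integrable_sum => // i _; apply: integrableZl => //.
exact: integrable_indic.
Qed.

Lemma expectation_index (f : 'I_k -> R) :
  ('E_P[fun t => f (I t)] = \sum_i (f i)%:E * P (I @^-1` [set i]))%E.
Proof.
rewrite unlock; under eq_integral do rewrite index_indic -sumEFin.
under eq_integral do under eq_bigr do rewrite EFinM.
rewrite integral_sum// => [|i].
  apply: eq_bigr => i _; rewrite integralZl//.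
    by rewrite integral_indic// setIT.
  exact: integrable_indic.
apply: integrableZl => //; exact: integrable_indic.
Qed.

(** Obtained by evaluating the expectation of the constant 1 in two ways. *)
Lemma sum_probability_index : (\sum_i P (I @^-1` [set i]) = 1)%E.
Proof.
have := expectation_index (fun=> 1); rewrite [LHS]expectation_cst => ->.
by apply: eq_bigr => i _; rewrite mul1e.
Qed.

(** Common form of every coordinate of the estimator: [c] is a coordinate of g(w0), [v] the
    increment of w, and [a] the entries of [A] (up to sign) among which the index selects. The law
    of [I] is prescribed only for [v <> 0], where the quotient is a probability. *)
Lemma expectation_sampled (v : 'cV[R]_k) (c : R) (a : 'I_k -> R) :
  (v <> 0 ->
    forall i, P (I @^-1` [set i]) = (`|v i 0| / l1norm v)%:E) ->
  'E_P[(fun t => c + l1norm v * Num.sg (v (I t) 0) * a (I t))%R]%E =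
    (c + \sum_i v i 0 * a i)%:E.
Proof.
move=> hP.
rewrite (expectation_index (fun i => c + l1norm v * Num.sg (v i 0) * a i)).
have [v0|v0] := eqVneq v 0.
  (* For [v = 0] the law of [I] is unknown, but the sampled term vanishes, so only the total mass 1
     matters. *)
  transitivity (c%:E * \sum_i P (I @^-1` [set i]))%E.
    rewrite ge0_sume_distrr//; apply: eq_bigr => i _.
    by rewrite v0 mxE sgr0 mulr0 mul0r addr0.
  rewrite sum_probability_index mule1 big1 ?addr0// => i _.
  by rewrite v0 mxE mul0r.
have {}hP := hP (elimN eqP v0).
have l0 : l1norm v != 0 by apply: contra_neq v0; exact: l1norm_eq0.
(* The weights sum to 1, so the constant [c] comes out of the mean unchanged. *)
have p1 : \sum_i `|v i 0| / l1norm v = 1 by rewrite -mulr_suml divff.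
under eq_bigr do rewrite hP -EFinM mulrDl.
rewrite sumEFin big_split/= -mulr_sumr p1 mulr1.
congr (_ + _)%:E; apply: eq_bigr => i _.
(* Writing [v i 0] as its sign times its modulus matches the two sides; the factor [l1norm v]
   cancels against the denominator of the probability. *)
rewrite [in RHS](numEsg (v i 0)); field.
by rewrite l0.
Qed.

End SampledIndex.

Section Estimator.
Context {R : realType} {m n : nat}.
Variables (A : 'M[R]_(m, n)) (w0 w : vec R n m).

Lemma estimate1E (i : 'I_m) (j : 'I_n) (k : 'I_n) :
  (estimate A w0 w i j).1 k 0 = (gradmap A w0).1 k 0 +
    l1norm (w.2 - w0.2) * Num.sg ((w.2 - w0.2) i 0) * A i k.
Proof. by rewrite !mxE. Qed.

Lemma estimate2E (i : 'I_m) (j : 'I_n) (k : 'I_m) :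
  (estimate A w0 w i j).2 k 0 = (gradmap A w0).2 k 0 +
    l1norm (w.1 - w0.1) * Num.sg ((w.1 - w0.1) j 0) * - A k j.
Proof. by rewrite !mxE mulrN. Qed.

(** Linearity of g, read coordinatewise: the mean increment is g(w) - g(w0). *)
Lemma gradmap1_increment (k : 'I_n) :
  (gradmap A w0).1 k 0 + \sum_i (w.2 - w0.2) i 0 * A i k = (gradmap A w).1 k 0.
Proof.
rewrite !mxE -big_split/=; apply: eq_bigr => i _.
by rewrite !mxE; ring.
Qed.

Lemma gradmap2_increment (k : 'I_m) :
  (gradmap A w0).2 k 0 + \sum_j (w.1 - w0.1) j 0 * - A k j =
    (gradmap A w).2 k 0.
Proof.
rewrite !mxE -!sumrN -big_split/=; apply: eq_bigr => i _.
by rewrite !mxE; ring.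
Qed.

(** Once g(w0) cancels, what remains is a function of [i] alone plus a function of [j] alone. Both
    the pointwise bound and the measurability of the squared norm rest on this splitting. *)
Lemma dual_znorm_estimate (i : 'I_m) (j : 'I_n) :
  dual_znorm (estimate A w0 w i j - gradmap A w0) ^+ 2 =
    mx_norm ((l1norm (w.2 - w0.2) * Num.sg ((w.2 - w0.2) i 0)) *: (row i A)^T)
      ^+ 2 +
    mx_norm (- ((l1norm (w.1 - w0.1) * Num.sg ((w.1 - w0.1) j 0)) *: col j A))
      ^+ 2.
Proof.
by rewrite /estimate [X in X - _]addrC addrK sqr_sqrtr// addr_ge0 ?sqr_ge0.
Qed.

Lemma dual_znorm_estimate_le (i : 'I_m) (j : 'I_n) :
  dual_znorm (estimate A w0 w i j - gradmap A w0) ^+ 2 <=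
    mx_norm A ^+ 2 * znorm (w - w0) ^+ 2.
Proof.
(* Since a sign has modulus at most 1, the bound is uniform in the sampled index [l]. *)
have entry_le k (v : 'cV[R]_k) (l : 'I_k) (x : R) : `|x| <= mx_norm A ->
    `|l1norm v * Num.sg (v l 0) * x| <= mx_norm A * l1norm v.
  move=> xA; rewrite mulrC normrM ler_pM// normrM ger0_norm ?l1norm_ge0//.
  by rewrite ler_piMr ?l1norm_ge0// normr_sg_le1.
have bound_ge0 k (v : 'cV[R]_k) : 0 <= mx_norm A * l1norm v.
  by rewrite mulr_ge0 ?mx_norm_ge0 ?l1norm_ge0.
rewrite dual_znorm_estimate sqr_sqrtr ?addr_ge0 ?sqr_ge0//.
(* The blocks are crossed: the first component of the covector is controlled by the y-increment and
   the second by the x-increment, hence the swap. *)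
rewrite mulrDr -!exprMn [X in _ <= X]addrC.
apply: lerD; rewrite ler_pXn2r ?nnegrE ?mx_norm_ge0 ?bound_ge0//.
  apply: mx_norm_le => // k l.
  rewrite [X in `|X|]mxE [X in _ * X]mxE [X in _ * X]mxE; apply: entry_le.
  exact: ler_mx_norm.
rewrite mx_normN; apply: mx_norm_le => // k l.
rewrite [X in `|X|]mxE [X in _ * X]mxE; apply: entry_le.
exact: ler_mx_norm.
Qed.

End Estimator.

Theorem lemma2 (R : realType) (m n : nat) (A : 'M[R]_(m, n)) (w0 : vec R n m)
  (hw0 : Zdom n m w0)
  (d : measure_display) (T : measurableType d) (P : probability T R)
  (I : vec R n m -> T -> 'I_m) (J : vec R n m -> T -> 'I_n)
  (hI : forall w, Zdom n m w -> random_index (I w))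
  (hJ : forall w, Zdom n m w -> random_index (J w))
  (hIJ : forall w, Zdom n m w -> independent_indices P (I w) (J w))
  (hp : forall w, Zdom n m w -> w.2 <> w0.2 ->
     forall i, P (I w @^-1` [set i]) = (row_prob w0 w i)%:E)
  (hq : forall w, Zdom n m w -> w.1 <> w0.1 ->
     forall j, P (J w @^-1` [set j]) = (col_prob w0 w j)%:E) :
  centered P w0 (mx_norm A) (gradmap A)
    (fun w t => estimate A w0 w (I w t) (J w t)).
Proof.
move=> w Zw; have [mI mJ] := (hI w Zw, hJ w Zw).
have pI : w.2 - w0.2 <> 0 -> forall i, P (I w @^-1` [set i]) =
    (`|(w.2 - w0.2) i 0| / l1norm (w.2 - w0.2))%:E.
  move=> v0 i; rewrite hp//; last by move=> ww0; rewrite ww0 subrr in v0.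
  by rewrite /row_prob !mxE.
have pJ : w.1 - w0.1 <> 0 -> forall j, P (J w @^-1` [set j]) =
    (`|(w.1 - w0.1) j 0| / l1norm (w.1 - w0.1))%:E.
  move=> v0 j; rewrite hq//; last by move=> ww0; rewrite ww0 subrr in v0.
  by rewrite /col_prob !mxE.
split; first split=> k.
(* The first component depends on the row index only, and the second, below, on the column index
   only. *)
- under eq_fun do rewrite estimate1E.
  split.
    exact: (integrable_index P mI
      (fun i => _ + _ * Num.sg (_ i 0) * A i k)).
  by rewrite (expectation_sampled mI _ (fun i => A i k) pI) gradmap1_increment.
- under eq_fun do rewrite estimate2E.
  split.
    exact: (integrable_index P mJ
      (fun j => _ + _ * Num.sg (_ j 0) * - A k j)).
  by rewrite (expectation_sampled mJ _ (fun j => - A k j) pJ) gradmap2_increment.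
(* Reading the bound as the expectation of a constant lets monotonicity reduce the claim to the
   pointwise inequality. *)
rewrite -(expectation_cst P); apply: expectation_le => //.
- under eq_fun do rewrite dual_znorm_estimate.
  apply: measurable_funD.
    exact: (measurable_index mI
      (fun i => mx_norm ((_ * Num.sg (_ i 0)) *: (row i A)^T) ^+ 2)).
  exact: (measurable_index mJ
    (fun j => mx_norm (- ((_ * Num.sg (_ j 0)) *: col j A)) ^+ 2)).
- by move=> t; exact: sqr_ge0.
- by move=> t; rewrite mulr_ge0 ?sqr_ge0.
- by apply: aeW => t; exact: dual_znorm_estimate_le.
Qed.
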